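(* Let $R$ be a commutative Noetherian ring with identity and let $M$ be a finitely generated unitary $R$-module. Let $n\ge 1$ and let $\mathfrak{p}_1,\dots,\mathfrak{p}_n$ be prime ideals in $R$, not necessarily distinct, such that $\mathfrak{p}_i$ is maximal (under inclusion) among $\{\mathfrak{p}_i,\dots,\mathfrak{p}_n\}$ for $1\le i\le n$. Let $\mathfrak{a}=\mathfrak{p}_1\cdots\mathfrak{p}_n$, $\mathfrak{a}_0=R$, and $\mathfrak{a}_i=\mathfrak{p}_1\cdots\mathfrak{p}_i$ for $i=1,\dots,n$ (so $\mathfrak{a}_n=\mathfrak{a}$). Then $\mathcal{P}_M(\mathfrak{a}M)=\mathfrak{p}_1\cdots\mathfrak{p}_n$ if and only if $$\mathrm{Ass}\left(\frac{(\mathfrak{a}M:\mathfrak{a}_i)}{(\mathfrak{a}M:\mathfrak{a}_{i-1})}\right)=\{\mathfrak{p}_i\}\quad\text{for every }1\le i\le n.$$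
   Context: Let $R$ be a commutative Noetherian ring with identity and $M$ a finitely generated $R$-module. For submodules $N, K$ of $M$, $(N:K)=\{a\in R: aK\subseteq N\}$. For an ideal $\mathfrak{b}$ of $R$ and a submodule $N$ of $M$, $(N:\mathfrak{b})=\{x\in M:\mathfrak{b}x\subseteq N\}$, a submodule of $M$. A proper submodule $N$ of a module $K$ is a prime submodule of $K$ if for all $a\in R$, $x\in K$, $ax\in N$ implies $a\in(N:K)$ or $x\in N$; then $\mathfrak{p}=(N:K)$ is a prime ideal and $N$ is called a $\mathfrak{p}$-prime submodule of $K$. For submodules $N\subset K$ of $M$, $K$ is a $\mathfrak{p}$-prime extension of $N$ in $M$ if $N$ is a $\mathfrak{p}$-prime submodule of $K$. It is a maximal $\mathfrak{p}$-prime extension of $N$ in $M$ if $K$ is maximal among the submodules of $M$ that are $\mathfrak{p}$-prime extensions of $N$ in $M$. A maximal $\mathfrak{p}$-prime extension $K$ of $N$ in $M$ is regular if $\mathfrak{p}$ is a maximal element (under inclusion) of $\mathrm{Ass}(M/N)$. For a proper submodule $N$ of $M$, a regular prime extension (RPE) filtration of $M$ over $N$ is a chain $N=M_0\subset M_1\subset\cdots\subset M_k=M$ together with primes $\mathfrak{q}_1,\dots,\mathfrak{q}_k$ such that $M_i$ is a regular $\mathfrak{q}_i$-prime extension of $M_{i-1}$ in $M$ for $1\le i\le k$. It is known that every proper submodule $N$ admits an RPE filtration and that the number of times each prime ideal occurs in it is independent of the filtration. The generalized prime ideal factorization $\mathcal{P}_M(N)$ of a proper submodule $N$ in $M$ is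 the product $\mathfrak{q}_1\cdots\mathfrak{q}_k$ of the primes occurring in any RPE filtration of $M$ over $N$, regarded as a formal product: the assertion $\mathcal{P}_M(N)=\mathfrak{p}_1\cdots\mathfrak{p}_n$ means that $N$ is a proper submodule of $M$ and the primes occurring in an RPE filtration of $M$ over $N$ are, counted with multiplicity and up to order, exactly $\mathfrak{p}_1,\dots,\mathfrak{p}_n$. The ideals $\mathfrak{a}$ and $\mathfrak{a}_i$ and the module $\mathfrak{a}M$ are formed with the usual product of ideals. *)

(* Defs.v *)
From HB Require Import structures.
From mathcomp Require Import all_boot all_order all_algebra.
From mathcomp Require Import boolp classical_sets.

Set Implicit Arguments.
Unset Strict Implicit.
Unset Printing Implicit Defensive.

Import GRing.Theory.
Local Open Scope classical_set_scope.
Local Open Scope ring_scope.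

(* Submodules of an R-module M are sets [N : set M] satisfying [submodule].
   Ideals of R are the submodules of the regular module R^o. *)

Section Submodules.
Context {R : comPzRingType} {M : lmodType R}.
Implicit Types (N K L : set M) (I p q : set R^o).

Definition submodule N : Prop := submod_closed (mem N).

Definition span (X : set M) : set M := smallest submodule X.

Definition finitely_generated N : Prop :=
  exists s : seq M, N = span [set` s].

(* I N; when M is R^o this is the usual product of ideals. *)
Definition ideal_mul I N : set M := span [set a *: x | a in I & x in N].

(* (N : K), an ideal of R. *)
Definition colon N K : set R^o := [set a | forall x, K x -> N (a *: x)].

(* (N : I), a submodule of M. *)
Definition colon_ideal N I : set M := [set x | forall a, I a -> N (a *: x)].

Definition prime_submodule N K : Prop :=
  [/\ submodule N, submodule K, N `<` K &
      forall a x, K x -> N (a *: x) -> colon N K a \/ N x].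

Definition prime_extension p N K : Prop :=
  prime_submodule N K /\ colon N K = p.

Definition maximal_prime_extension p N K : Prop :=
  prime_extension p N K /\
  forall L, prime_extension p N L -> K `<=` L -> L = K.

End Submodules.

Definition noetherian (R : comPzRingType) : Prop :=
  forall I : set R^o, submodule I -> finitely_generated I.

Definition prime_ideal (R : comPzRingType) (p : set R^o) : Prop :=
  [/\ submodule p, ~ p 1 & forall a b : R, p (a * b) -> p a \/ p b].

Section RPE.
Context {R : comPzRingType} {M : lmodType R}.
Implicit Types (N K : set M) (p q : set R^o).

(* Ass (K / N) for submodules N of K: the annihilator of the class of x in
   K / N is the set of all a such that a x lies in N. *)
Definition Ass_quot K N : set (set R^o) :=
  [set p | prime_ideal p /\ exists2 x, K x & p = [set a | N (a *: x)]].

(* Here f plays the role of the projection M -> M / N, so that f @` K is K / N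
   and the set of all a such that a y = 0 is the annihilator of y. *)
Lemma Ass_quotE (Q : lmodType R) (f : {linear M -> Q}) K N :
  N = f @^-1` [set 0] ->
  Ass_quot K N = [set p | prime_ideal p /\
    exists2 y, (f @` K) y & p = [set a : R^o | (a : R) *: y = 0]].
Proof.
move=> ->; apply/seteqP; split=> p [pp [x Kx pE]]; split=> //.
  exists (f x); first by exists x.
  by rewrite pE; apply/seteqP; split=> a /=; rewrite linearZ.
case: Kx pE => z Kz <- ->; exists z => //.
by apply/seteqP; split=> a /=; rewrite linearZ.
Qed.

Definition regular_prime_extension p N K : Prop :=
  [/\ maximal_prime_extension p N K,
      Ass_quot setT N p &
      forall q, Ass_quot setT N q -> p `<=` q -> q = p].

Definition rpe_filtration N (qs : seq (set R^o)) : Prop :=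
  exists Ms : nat -> set M,
    [/\ Ms 0%N = N, Ms (size qs) = setT &
        forall i, (i < size qs)%N ->
          regular_prime_extension (nth set0 qs i) (Ms i) (Ms i.+1)].

(* The assertion P_M(N) = p_1 ... p_n for ps = [:: p_1; ...; p_n]. *)
Definition gen_prime_factorization N (ps : seq (set R^o)) : Prop :=
  [/\ submodule N, N `<` setT &
      exists qs, rpe_filtration N qs /\ perm_eq qs ps].

End RPE.

(* The empty product is the unit ideal R. *)
Definition ideal_prod (R : comPzRingType) (ps : seq (set R^o)) : set R^o :=
  \big[ideal_mul/setT]_(p <- ps) p.

(* Main.v *)
(** For a prime [q] maximal in Ass (M / N), the only regular [q]-prime extension
    of [N] is [(N : q)], so an RPE filtration is a chain of iterated colons
    [(N : q_1 ... q_i)].  Since [M / (N : q)] embeds in a finite power of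
    [M / N], these chains have decreasing sets of associated primes, and two
    distinct maximal associated primes can be exchanged in a filtration.  Hence
    the primes of a filtration may be listed in any order in which each one is
    maximal among its successors; in the order of [p], the filtration of
    [N = aM] is the chain of the [(aM : a_i)].  Conversely, that
    chain is a filtration as soon as each [p_i] is maximal among
    [p_i, ..., p_n], because these primes contain Ass (M / (aM : a_(i-1))). *)

Require Import Defs.
From mathcomp Require Import all_boot all_order all_algebra.
From mathcomp Require Import boolp classical_sets.

Set Implicit Arguments.
Unset Strict Implicit.
Unset Printing Implicit Defensive.

Import GRing.Theory.
Local Open Scope classical_set_scope.
Local Open Scope ring_scope.

(** * Submodules presented as subsets *)

Section Submodules.
Context {R : comPzRingType} {M : lmodType R}.
Implicit Types (N K : set M) (I J p q : set R^o).

Lemma submoduleP N : submodule N <->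
  N 0 /\ forall (a : R) x y, N x -> N y -> N (a *: x + y).
Proof.
split=> -[N0 Nlin].
  by split=> [|a x y Nx Ny]; apply/set_mem => //; apply: Nlin; exact/mem_set.
by split=> [|a x y /set_mem Nx /set_mem Ny]; apply/mem_set => //; exact: Nlin.
Qed.

Lemma submodule0 N : submodule N -> N 0.
Proof. by case/submoduleP. Qed.

Lemma submoduleZ N (a : R) x : submodule N -> N x -> N (a *: x).
Proof. by case/submoduleP=> N0 Nlin Nx; rewrite -[_ *: _]addr0; exact: Nlin. Qed.

Lemma submodule_span (X : set M) : submodule (Defs.span X).
Proof.
apply/submoduleP; split=> [K [/submodule0]//|a x y Xx Xy K [sK XK]].
by case/submoduleP: (sK) => _; apply; [exact: Xx|exact: Xy].
Qed.

End Submodules.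

(** * Colon submodules and annihilators *)

Section Colon.
Context {R : comPzRingType} {M : lmodType R}.
Implicit Types (N K : set M) (I J p q : set R^o).

Lemma submodule_colon_ideal N I : submodule N -> submodule (colon_ideal N I).
Proof.
move=> sN; case/submoduleP: (sN) => N0 Nlin; apply/submoduleP.
split=> [a _|a x y Nx Ny b Ib]; first by rewrite scaler0.
rewrite scalerDr scalerA mulrC -scalerA; apply: Nlin; [exact: Nx|exact: Ny].
Qed.

(** This is the annihilator of the class of [x] in M / N; the primes of this form are the members of
    [Ass_quot setT N]. *)
Definition ann N x : set R^o := [set a | N ((a : R) *: x)].

Lemma submodule_ann N x : submodule N -> submodule (ann N x).
Proof.
move=> /submoduleP[N0 Nlin]; apply/submoduleP; split=> [|a b c Nb Nc].
  by rewrite /ann /= scale0r.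
by rewrite /ann /= scalerDl -scalerA; exact: Nlin.
Qed.

Lemma sub_colon_ideal N I : submodule N -> N `<=` colon_ideal N I.
Proof. by move=> sN x Nx a _; exact: submoduleZ. Qed.

Lemma colon_idealT N : submodule N -> colon_ideal N setT = N.
Proof.
move=> sN; apply/seteqP; split; last exact: sub_colon_ideal.
by move=> x /(_ 1 I); rewrite scale1r.
Qed.

Lemma colon_idealC N I J :
  colon_ideal (colon_ideal N I) J = colon_ideal (colon_ideal N J) I.
Proof.
by apply/seteqP; split=> x Nx a Ia b Ib; rewrite scalerA mulrC -scalerA; exact: Nx.
Qed.

Lemma colon_ideal_mul N I J : submodule N ->
  colon_ideal N (ideal_mul I J) = colon_ideal (colon_ideal N I) J.
Proof.
move=> sN; apply/seteqP; split=> x Nx.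
  move=> b Jb a Ia; rewrite scalerA; apply: Nx => K [_]; apply.
  by exists a => //; exists b.
(* [Ic] puts [c] in every ideal containing the products of elements of [I] and [J]; the ideal
   [ann N x] is one of them. *)
move=> c Ic; apply: (Ic (ann N x)); split; first exact: submodule_ann.
by move=> _ [a Ia [b Jb <-]]; rewrite /ann /= -scalerA; exact: Nx.
Qed.

Lemma colon_ideal_prod_cons N q (s : seq (set R^o)) : submodule N ->
  colon_ideal N (ideal_prod (q :: s)) =
  colon_ideal (colon_ideal N q) (ideal_prod s).
Proof. by move=> sN; rewrite /ideal_prod big_cons colon_ideal_mul. Qed.

Lemma colon_ideal_prod_nil N : submodule N -> colon_ideal N (ideal_prod [::]) = N.
Proof. by move=> sN; rewrite /ideal_prod big_nil colon_idealT. Qed.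

(** The class of [x] generates a copy of the domain R / p, where every nonzero element has
    annihilator p. *)
Lemma prime_ann_scale N x (c : R) : prime_ideal (ann N x) -> ~ ann N x c ->
  ann N (c *: x) = ann N x.
Proof.
case=> sp _ pM Nc; apply/seteqP; split=> a; rewrite /ann /= scalerA.
  by move=> /pM[].
by rewrite mulrC => pa; exact: (submoduleZ c sp pa).
Qed.

End Colon.

(** * Existence of associated primes over a Noetherian ring *)

Section Noetherian.
Context {R : comPzRingType} {M : lmodType R}.
Hypothesis noethR : noetherian R.
Implicit Types (N K : set M) (p q : set R^o).

(** The union of the chain is an ideal with finitely many generators, and these already lie in a
    single member of the chain. *)
Lemma noetherian_chain (T : Type) (F : T -> set R^o) (A : set T) (t0 : T) :
  (forall t, submodule (F t)) -> A t0 ->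
  total_on A (fun s t => F s `<=` F t) ->
  exists2 t, A t & forall s, A s -> F s `<=` F t.
Proof.
move=> sF At0 Atot; pose U := [set a | exists2 t, A t & F t a].
have sU : submodule U.
  apply/submoduleP; split; first by exists t0 => //; exact: submodule0.
  move=> a x y [s As Fx] [t At Fy].
  have [st|ts] := Atot _ _ As At.
    by exists t => //; case/submoduleP: (sF t) => _; apply=> //; exact: st.
  by exists s => //; case/submoduleP: (sF s) => _; apply=> //; exact: ts.
have [g Ug] := noethR sU.
have : exists2 t, A t & forall b, b \in g -> F t b.
  have : {in g, forall b, U b} by move=> b bg; rewrite Ug => K [_]; exact.
  elim: (g) => [|b r IHr] rU; first by exists t0.
  have [|s As Fs] := IHr; first by move=> c cr; apply: rU; rewrite inE cr orbT.
  have [t At Ft] := rU b (mem_head _ _).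
  have [st|ts] := Atot _ _ As At.
    by exists t => // c; rewrite inE => /predU1P[->//|/Fs/st].
  by exists s => // c; rewrite inE => /predU1P[->|/Fs//]; exact: ts.
move=> [t At Ft]; exists t => // s As a Fa.
have : U a by exists s.
by rewrite Ug; apply: smallest_sub.
Qed.

(** Zorn's lemma yields a maximal annihilator among the elements outside [N] whose annihilator
    contains [ann N x]; such a maximal annihilator is prime. *)
Lemma Ass_quot_above N x : submodule N -> ~ N x ->
  exists2 p, Ass_quot setT N p & ann N x `<=` p.
Proof.
move=> sN Nx; pose T := {y | ~ N y /\ ann N x `<=` ann N y}.
pose le (y z : T) := `[< ann N (sval y) `<=` ann N (sval z) >].
pose x0 : T := exist _ x (conj Nx (@subset_refl _ _)).
have [||A Atot|[y [Ny xy]] ymax] := @ZL_preorder T x0 le.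
- by move=> t; apply/asboolP.
- by move=> r s t /asboolP rs /asboolP st; apply/asboolP; exact: subset_trans st.
(* The empty chain is bounded by [x0]; [noetherian_chain] needs a nonempty one. *)
- have [[t0 At0]|A0] := pselect (exists t, A t); last first.
    by exists x0 => s As; case: A0; exists s.
  have [||t _ tmax] := noetherian_chain (F := fun t : T => ann N (sval t)) _ At0.
  + by move=> t; exact: submodule_ann.
  + by move=> s t As At; have [/asboolP|/asboolP] := Atot s t As At; [left|right].
  + by exists t => s /tmax ?; apply/asboolP.
exists (ann N y) => //; split; last by exists y.
split; [exact: submodule_ann|by rewrite /ann /= scale1r|move=> a b ab].
have [|Nby] := pselect (N (b *: y)); [by right|left].
have yby : ann N y `<=` ann N (b *: y).
  by move=> c yc; rewrite /ann /= scalerA mulrC -scalerA; exact: submoduleZ.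
(* [b *: y] competes with [y], so by maximality its annihilator, which contains [a], is no larger
   than that of [y]. *)
pose z : T := exist _ (b *: y) (conj Nby (subset_trans xy yby)).
have /asboolP := ymax z (asboolT yby).
by apply; rewrite /ann /= scalerA.
Qed.

(** * Regular prime extensions as colon submodules *)

Definition maximal_Ass N p : Prop :=
  Ass_quot setT N p /\ forall q, Ass_quot setT N q -> p `<=` q -> q = p.

Lemma prime_extension_ann p N K x :
  prime_extension p N K -> K x -> ~ N x -> ann N x = p.
Proof.
move=> [[_ _ _ NK] <-] Kx Nx; apply/seteqP; split=> a; last exact.
by move=> /NK[].
Qed.

(** For [y] in (N : p) outside [N], the annihilator contains [p] and lies in some associated prime;
    maximality of [p] squeezes it to [p]. *)
Lemma maximal_Ass_prime_extension N p :
  submodule N -> maximal_Ass N p -> prime_extension p N (colon_ideal N p).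
Proof.
move=> sN [[pp [x _ px]] pmax].
have Nx : ~ N x by case: pp => _ p1 _ Nx; apply: p1; rewrite px /= scale1r.
have Kx : colon_ideal N p x by move=> a; rewrite px.
have annE y : colon_ideal N p y -> ~ N y -> ann N y = p.
  move=> Ky Ny; have [q qA yq] := Ass_quot_above sN Ny.
  have py : p `<=` ann N y by move=> a /Ky.
  apply/seteqP; split=> // a /yq.
  by rewrite (pmax q qA) //; exact: subset_trans yq.
split; last first.
  apply/seteqP; split=> a; first by rewrite px; exact.
  by move=> pa y; exact.
split=> //.
- exact: submodule_colon_ideal.
- split; first exact: sub_colon_ideal.
  by move=> /(_ x Kx).
- move=> a y Ky Nay; have [|Ny] := pselect (N y); first by right.
  have pa : p a by rewrite -(annE y Ky Ny).
  by left=> z; exact.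
Qed.

(** Every [p]-prime extension of [N] lies in (N : p), which is itself one when [p] is maximal in Ass
    (M / N); hence it is the only maximal one. *)
Lemma regular_prime_extensionP N p K : submodule N ->
  regular_prime_extension p N K <-> maximal_Ass N p /\ K = colon_ideal N p.
Proof.
move=> sN; split=> [[[pK Kmax] pA pmax]|[pA ->]].
  split=> //; apply: esym; apply: Kmax; first exact: maximal_Ass_prime_extension.
  by case: pK => _ <- x Kx a; exact.
case: (pA) => pA1 pmax; split=> //.
split; first exact: maximal_Ass_prime_extension.
move=> L [_ pE] KL; apply/seteqP; split=> // x Lx a.
by rewrite -pE; exact.
Qed.

(** * Associated primes of extensions, quotients and colons *)

Lemma Ass_quot_ext p N K : prime_ideal p -> prime_extension p N K ->
  Ass_quot K N = [set p].
Proof.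
move=> pp pK; apply/seteqP; split=> [q [[_ q1 _] [x Kx qx]]|_ ->].
  rewrite /= qx; apply: prime_extension_ann pK Kx _ => Nx; apply: q1.
  by rewrite qx /= scale1r.
split=> //; case: (pK) => -[_ _ [_ /existsNP[x /not_implyP[Kx Nx]]] _] _.
by exists x => //; rewrite -(prime_extension_ann pK Kx Nx).
Qed.

(** A copy of R / p in M / N either meets K / N in a nonzero element, again of annihilator [p], or
    embeds in M / K. *)
Lemma Ass_quot_trans N K p : N `<=` K -> Ass_quot setT N p ->
  Ass_quot K N p \/ Ass_quot setT K p.
Proof.
move=> NK [pp [x _ px]].
have [[c [pc Kc]]|Kx] := pselect (exists c : R, ~ p c /\ K (c *: x)).
  left; split=> //; exists (c *: x) => //.
  by rewrite {1}px; apply/esym/(prime_ann_scale (N := N)); rewrite /ann -px.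
right; split=> //; exists x => //; apply/seteqP; split=> a /=.
  by rewrite px => /NK.
by move=> Ka; apply: contrapT => pa; apply: Kx; exists a.
Qed.

(* With [q] generated by [b_1, ..., b_r], the map x |-> (b_1 x, ..., b_r x)
   embeds M / (N : q) in (M / N)^r. *)
Lemma Ass_quot_colon_ideal N q : submodule N -> submodule q ->
  Ass_quot setT (colon_ideal N q) `<=` Ass_quot setT N.
Proof.
move=> sN sq p [pp [x _ px]]; split=> //.
have [g qg] := noethR sq.
have [[b [bg pb]]|nb] :=
    pselect (exists b : R, q b /\ forall c : R, N (c *: (b *: x)) -> p c).
  exists (b *: x) => //; apply/seteqP; split=> [c|c /pb//].
  by rewrite px => /(_ b bg); rewrite /= !scalerA mulrC.
(* Otherwise, for each generator [b] of [q], some element outside [p] sends [b *: x] into [N]. The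
   product [c] of these elements is outside the prime [p], yet [c *: x] lies in (N : q), a
   contradiction. *)
have [c pc Nc] : exists2 c : R, ~ p c &
    forall b : R, b \in (g : seq R) -> N (c *: (b *: x)).
  have : {in (g : seq R), forall b, q b} by move=> b bg; rewrite qg => K [_]; exact.
  case: (pp) => _ p1 pM.
  elim: (g : seq R) => [|b r IHr] rq; first by exists 1.
  have [|c pc Nc] := IHr; first by move=> d dr; apply: rq; rewrite inE dr orbT.
  have [d Nd pd] : exists2 d : R, N (d *: (b *: x)) & ~ p d.
    apply: contrapT => nd; apply: nb; exists b; split; first exact/rq/mem_head.
    by move=> d Nd; apply: contrapT => pd; apply: nd; exists d.
  exists (c * d) => [/pM[]//|e]; rewrite inE => /predU1P[->|/Nc Ne].
    by rewrite -scalerA; exact: submoduleZ.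
  by rewrite mulrC -scalerA; exact: submoduleZ.
case: pc; rewrite px /= => b.
rewrite qg => /(_ (ann N (c *: x))); apply; split; first exact: submodule_ann.
by move=> d /Nc; rewrite /ann /= !scalerA mulrC.
Qed.

(** * Filtrations recorded by their primes *)

Lemma maximal_Ass_submodule N p : maximal_Ass N p -> submodule p.
Proof. by case=> -[[]]. Qed.

(** Only the primes are kept, since by [regular_prime_extensionP] each prime forces the next
    submodule. *)
Fixpoint filtration N (qs : seq (set R^o)) : Prop :=
  if qs is q :: qs' then maximal_Ass N q /\ filtration (colon_ideal N q) qs'
  else N = setT.

Lemma rpe_filtrationP N qs : submodule N ->
  rpe_filtration N qs <-> filtration N qs.
Proof.
elim: qs N => [|q qs IHqs] N sN.
  by split=> [[Ms [<- ->]]//|->]; exists (fun=> setT).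
have sK := submodule_colon_ideal q sN.
split=> [[Ms [M0 Mn MS]]|[qN /(IHqs _ sK)[Ms [M0 Mn MS]]]].
  have := MS 0%N isT; rewrite M0 => /(regular_prime_extensionP _ _ sN)[qN M1].
  split=> //; apply/(IHqs _ sK); exists (Ms \o succn); split=> // i iqs.
  exact: (MS i.+1).
exists (fun i => if i is j.+1 then Ms j else N); split=> // -[_|i iqs].
  by rewrite M0; apply/regular_prime_extensionP.
exact: MS.
Qed.

(** By [Ass_quot_trans], an associated prime of M / N comes from some factor of the filtration, and
    each factor has only its own prime. *)
Lemma filtration_Ass N qs p : submodule N ->
  filtration N qs -> Ass_quot setT N p -> p \in qs.
Proof.
elim: qs N => [|q qs IHqs] N sN /= => [->|[qN qs_filt]] pA.
  by case: pA => -[_ p1 _] [x _ px]; case: p1; rewrite px.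
have [|pK] := Ass_quot_trans (sub_colon_ideal (I := q) sN) pA.
  rewrite (Ass_quot_ext _ (maximal_Ass_prime_extension sN qN)).
    by move=> ->; exact: mem_head.
  by case: qN => -[].
by rewrite inE (IHqs _ (submodule_colon_ideal _ sN) qs_filt pK) orbT.
Qed.

Lemma Ass_filtration N qs p : submodule N ->
  filtration N qs -> p \in qs -> Ass_quot setT N p.
Proof.
elim: qs N => [|q qs IHqs] N sN //= [qN qs_filt].
rewrite inE => /predU1P[->|pqs]; first by case: qN.
apply: (Ass_quot_colon_ideal sN (maximal_Ass_submodule qN)).
exact: IHqs (submodule_colon_ideal _ sN) qs_filt pqs.
Qed.

(** * Reordering the primes of a filtration *)

(** Maximality of [q] gives [b] in [q] outside [p]. If [p] is the annihilator of [x] modulo [N],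
    this [b] shows that it stays so modulo (N : q). *)
Lemma maximal_Ass_exchange N p q : submodule N ->
  maximal_Ass N p -> maximal_Ass N q -> p <> q ->
  maximal_Ass (colon_ideal N q) p.
Proof.
move=> sN pN qN pq; case: (pN) => -[pp [x _ px]] pmax.
split; last first.
  move=> r /(Ass_quot_colon_ideal sN (maximal_Ass_submodule qN)); exact: pmax.
have [b qb pb] : exists2 b, q b & ~ p b.
  apply: contrapT => nb; apply: pq; case: qN => _ qmax.
  apply: (qmax p pN.1) => b qb; apply: contrapT => pb; apply: nb.
  by exists b.
split=> //; exists x => //; apply/seteqP; split=> a /=.
  by rewrite px => Na c _; exact: submoduleZ.
move=> /(_ b qb); rewrite scalerA => Nba.
have : p (b * a) by rewrite px.
by case: pp => _ _ pM /pM[].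
Qed.

(** Thus [p] can be moved to the front: it is exchanged with each prime listed before its first
    occurrence. *)
Lemma filtration_rem N qs p : submodule N ->
  filtration N qs -> maximal_Ass N p -> filtration (colon_ideal N p) (rem p qs).
Proof.
elim: qs N => [|q qs IHqs] N sN /= qs_filt pN.
  by have := filtration_Ass sN (qs := [::]) qs_filt pN.1.
case: qs_filt => qN qs_filt; case: eqVneq => [<-//|/eqP qp /=].
split; first exact: maximal_Ass_exchange.
rewrite colon_idealC; apply: IHqs => //; first exact: submodule_colon_ideal.
by apply: maximal_Ass_exchange => // /esym.
Qed.

Definition maximal_first (ps : seq (set R^o)) : bool :=
  pairwise (fun p q : set R^o => `[< p `<=` q -> q = p >]) ps.

Lemma maximal_first_cons p ps q :
  maximal_first (p :: ps) -> q \in p :: ps -> p `<=` q -> q = p.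
Proof.
move=> /andP[/allP pps _]; rewrite inE => /predU1P[->//|/pps /asboolP].
exact.
Qed.

(** The primes of a filtration are exactly those of Ass (M / N), so the head of [ps] is maximal
    there and can be taken as the first step. *)
Lemma filtration_perm N qs ps : submodule N -> maximal_first ps ->
  perm_eq qs ps -> filtration N qs -> filtration N ps.
Proof.
elim: ps N qs => [|p ps IHps] N qs sN ps_max.
  by move=> /perm_nilP->.
move=> eq_qps qs_filt.
have pN : maximal_Ass N p.
  split.
    by apply: Ass_filtration qs_filt _; rewrite // (perm_mem eq_qps) mem_head.
  move=> q /(filtration_Ass sN qs_filt); rewrite (perm_mem eq_qps).
  exact: maximal_first_cons.
split=> //; apply: IHps (filtration_rem sN qs_filt pN).
- exact: submodule_colon_ideal.
- by case/andP: ps_max.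
- have pqs : p \in qs by rewrite (perm_mem eq_qps) mem_head.
  by rewrite -(perm_cons p); apply: perm_trans eq_qps; rewrite perm_sym perm_to_rem.
Qed.

(** * The chain of colons by partial products *)

(** This is the condition on Ass in the theorem, for an arbitrary [N] so that induction on [ps] can
    replace [N] by (N : p). Indices start at 0. *)
Definition colon_Ass N (ps : seq (set R^o)) : Prop :=
  forall i, (i < size ps)%N ->
    Ass_quot (colon_ideal N (ideal_prod (take i.+1 ps)))
             (colon_ideal N (ideal_prod (take i ps))) = [set nth set0 ps i].

Lemma colon_Ass_cons N p ps : submodule N -> colon_Ass N (p :: ps) <->
  Ass_quot (colon_ideal N p) N = [set p] /\ colon_Ass (colon_ideal N p) ps.
Proof.
move=> sN; have sK := submodule_colon_ideal p sN; split=> [Nps|[Np Kps] [_|i ips]].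
- split.
    have := Nps 0%N isT.
    by rewrite take0 /= take0 colon_ideal_prod_cons // !colon_ideal_prod_nil.
  by move=> i ips; have := Nps i.+1 ips; rewrite /= !colon_ideal_prod_cons.
- by rewrite take0 /= take0 colon_ideal_prod_cons // !colon_ideal_prod_nil.
- by rewrite /= !colon_ideal_prod_cons //; exact: Kps.
Qed.

Lemma filtration_colon_Ass N ps : submodule N -> filtration N ps -> colon_Ass N ps.
Proof.
elim: ps N => [|p ps IHps] N sN //= [pN ps_filt].
apply/(colon_Ass_cons _ _ sN); split.
  by apply: Ass_quot_ext (maximal_Ass_prime_extension sN pN); case: pN => -[].
exact: IHps (submodule_colon_ideal _ sN) ps_filt.
Qed.

(** The chain of colons ends at M, so [Ass_quot_trans] locates each associated prime of M / N in one
    of its factors. *)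
Lemma colon_Ass_sub N ps p : submodule N -> colon_Ass N ps ->
  colon_ideal N (ideal_prod ps) = setT -> Ass_quot setT N p -> p \in ps.
Proof.
elim: ps N => [|q ps IHps] N sN.
  move=> _; rewrite colon_ideal_prod_nil // => ->.
  by move=> [[_ p1 _] [x _ px]]; case: p1; rewrite px.
move=> /(colon_Ass_cons _ _ sN)[Nq Kps]; rewrite colon_ideal_prod_cons // => KT pA.
have sK := submodule_colon_ideal q sN.
have [|pK] := Ass_quot_trans (sub_colon_ideal (I := q) sN) pA.
  by rewrite Nq => ->; exact: mem_head.
by rewrite inE (IHps _ sK Kps KT pK) orbT.
Qed.

(** The head of [ps] is associated to M / N and maximal in [ps], which contains Ass (M / N) by
    [colon_Ass_sub]; hence it is maximal in Ass (M / N). *)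
Lemma colon_Ass_filtration N ps : submodule N -> maximal_first ps ->
  colon_Ass N ps -> colon_ideal N (ideal_prod ps) = setT -> filtration N ps.
Proof.
elim: ps N => [|p ps IHps] N sN ps_max.
  by rewrite colon_ideal_prod_nil.
move=> Nps NT; have /(colon_Ass_cons _ _ sN)[Np Kps] := Nps.
have sK := submodule_colon_ideal p sN.
split; last first.
  by apply: IHps => //; [case/andP: ps_max|rewrite -colon_ideal_prod_cons].
split.
  have : Ass_quot (colon_ideal N p) N p by rewrite Np.
  by move=> [pp [x _ px]]; split=> //; exists x.
move=> q /(colon_Ass_sub sN Nps NT); exact: maximal_first_cons.
Qed.

(** The first prime is the annihilator of a class in M / N and is a proper ideal, so that class is
    nonzero. *)
Lemma filtration_proper N ps : submodule N -> (0 < size ps)%N ->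
  filtration N ps -> N `<` setT.
Proof.
case: ps => // p ps sN _ [[[[_ p1 _] [x _ px]] _] _]; split=> // TN.
by apply: p1; rewrite px; exact: TN.
Qed.

End Noetherian.

Theorem theorem2p9 (R : comPzRingType) (M : lmodType R)
    (noethR : noetherian R)
    (fgM : finitely_generated [set: M])
    (n : nat) (n_gt0 : (0 < n)%N)
    (p : n.-tuple (set R^o))
    (p_prime : forall i : 'I_n, prime_ideal (tnth p i))
    (p_max : forall i j : 'I_n, (i <= j)%N ->
       tnth p i `<=` tnth p j -> tnth p j = tnth p i) :
  let a (i : nat) : set R^o := ideal_prod (take i p) in
  let aM : set M := ideal_mul (a n) [set: M] in
  gen_prime_factorization aM p <->
  forall i : 'I_n,
    Ass_quot (colon_ideal aM (a i.+1)) (colon_ideal aM (a i)) = [set tnth p i].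
Proof.
move=> a aM.
have sN : submodule aM := submodule_span _.
(* The product of all the primes sends M into [aM], so the chain of colons reaches M. *)
have NT : colon_ideal aM (ideal_prod p) = setT.
  apply/seteqP; split=> // x _ c pc K [_]; apply; exists c.
    by rewrite /a -{1}(size_tuple p) take_size.
  by exists x.
have ps_max : maximal_first p.
  apply/(pairwiseP set0) => i j; rewrite !inE !size_tuple => ilt jlt ij.
  apply/asboolP; have := p_max (Ordinal ilt) (Ordinal jlt) (ltnW ij).
  by rewrite !(tnth_nth set0).
have AssE : colon_Ass aM p <-> forall i : 'I_n,
    Ass_quot (colon_ideal aM (a i.+1)) (colon_ideal aM (a i)) = [set tnth p i].
  split=> [Np i|Np i]; first by rewrite (tnth_nth set0); apply: Np; rewrite size_tuple.
  by rewrite size_tuple => ilt; have := Np (Ordinal ilt); rewrite (tnth_nth set0).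
split=> [[_ _ [qs [/(rpe_filtrationP noethR _ sN) qs_filt eq_qp]]]|/AssE Np].
  apply/AssE/filtration_colon_Ass => //.
  (* The given filtration may list its primes in any order; it is rearranged into the order of
     [p]. *)
  exact: filtration_perm eq_qp qs_filt.
have p_filt := colon_Ass_filtration sN ps_max Np NT.
split=> //; first by apply: filtration_proper p_filt; rewrite ?size_tuple.
by exists p; split; [apply/rpe_filtrationP|].
Qed.
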